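(* Let $m,n,d,e,k$ be positive integers with $m=2n$, $e=\gcd(n,d)=\gcd(m,d)$ and $1\le k\le \frac{n}{e}$, and let $C$ be the binary code described in the context. If $c\in C$ is nonzero, then \[{\rm DC}(c)\in\{-1\}\cup\{-1\pm 2^{\frac{m}{2}+je}\mid j=0,1,\dots,k-1\}.\]
   Context: For $\vec a=(a_0,a_1,\dots,a_k)\in\mathbb{F}_{2^n}\times\mathbb{F}_{2^m}^k$ define $Q_{\vec a}:\mathbb{F}_{2^m}\to\mathbb{F}_{2^e}$ by \[Q_{\vec a}(x)={\rm Tr}_{\mathbb{F}_{2^n}/\mathbb{F}_{2^e}}\big(a_0x^{2^{nd/e}+1}\big)+\sum_{j=1}^{k-1}{\rm Tr}_{\mathbb{F}_{2^m}/\mathbb{F}_{2^e}}\big(a_jx^{2^{(\frac{n}{e}-j)d}+1}\big)+{\rm Tr}_{\mathbb{F}_{2^m}/\mathbb{F}_{2^e}}(a_kx).\] Here $x^{2^{nd/e}+1}\in\mathbb{F}_{2^n}$ for $x\in\mathbb{F}_{2^m}$. Let $\pi$ be a primitive element of $\mathbb{F}_{2^m}$. For each $\vec a$, let $c_{\vec a}=(c_{\vec a,0},\dots,c_{\vec a,2^m-2})\in\mathbb{F}_2^{2^m-1}$ with $c_{\vec a,i}={\rm Tr}_{\mathbb{F}_{2^e}/\mathbb{F}_2}(Q_{\vec a}(\pi^{-i}))$. Then $C=\{c_{\vec a}\mid \vec a\in\mathbb{F}_{2^n}\times\mathbb{F}_{2^m}^k\}$. Equivalently, $C$ is the $\mathbb{F}_2$-span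 of all cyclic shifts of an m-sequence $s$ of length $2^m-1$ and of its decimations by $2^{(\frac{n}{e}-j)d}+1$, $0\le j<k$. For $c=(c_0,\dots,c_{2^m-2})\in C$, the DC component is ${\rm DC}(c)=\sum_{i=0}^{2^m-2}(-1)^{c_i}$. *)

(* Defs.v *)
From mathcomp Require Import all_boot all_order all_algebra all_field.
Set Implicit Arguments. Unset Strict Implicit. Unset Printing Implicit Defensive.
Import GRing.Theory.
Local Open Scope ring_scope.

(* Relative trace Tr_{F_{2^(q r)} / F_{2^q}} (y) inside a field F of
   characteristic 2 containing F_{2^(q r)}:  sum_{i < r} y^(2^(q i)).
   Here we pass the degrees N (of the top field) and q (of the bottom
   field) and use r = N / q. *)
Definition Tr (F : finFieldType) (N q : nat) (y : F) : F :=
  \sum_(i < N %/ q) y ^+ (2 ^ (q * i)).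

(* Q_a(x), with a0 : F (assumed in F_{2^n}) and a j for j = 1..k. *)
Definition Qa (F : finFieldType) (m n d e k : nat) (a0 : F) (a : nat -> F)
    (x : F) : F :=
  Tr n e (a0 * x ^+ (2 ^ (n * d %/ e) + 1))
  + \sum_(1 <= j < k) Tr m e (a j * x ^+ (2 ^ ((n %/ e - j) * d) + 1))
  + Tr m e (a k * x).

(* The codeword coordinate c_{a,i} = Tr_{F_{2^e}/F_2}(Q_a(pi^{-i})) (an element
   of F_2 = {0,1} inside F). *)
Definition cw (F : finFieldType) (m n d e k : nat) (a0 : F) (a : nat -> F)
    (pi : F) (i : nat) : F :=
  Tr e 1 (Qa m n d e k a0 a (pi ^- i)).

Definition DC (F : finFieldType) (m n d e k : nat) (a0 : F) (a : nat -> F)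
    (pi : F) : int :=
  \sum_(i < 2 ^ m - 1) (if cw m n d e k a0 a pi i == 0 then 1 else -1).

(* Main.v *)
(* Write q for the quadratic function x |-> Tr(Q_a(x)) and S for the sum of
   (-1)^q(x) over F, so that DC = S - 1. Let W be the radical of the polar form
   of q. Then S^2 = |F| sum_{w in W} (-1)^q(w), and q is additive on W, so S^2 is
   0 or |F||W|. To see that |F||W| is an even power of 2^e, take a maximal
   totally isotropic F_{2^e}-subspace M: it is its own orthogonal, hence
   |M|^2 = |F||W|. Finally W is the kernel of a linearized polynomial in the
   Frobenius sigma = (x |-> x^(2^d)), with exponents between n/e-k+1 and n/e+k-1
   (this uses that d/e is odd, so that sigma^(n/e) = (x |-> x^(2^n))). Such a
   kernel has dimension at most 2(k-1) over the fixed field F_{2^e} of sigma,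
   unless all coefficients vanish; in that case q is linear and S = 0. *)
Require Import Defs.
From mathcomp Require Import all_boot all_order all_algebra all_field.
From mathcomp Require Import zify ring.
Import GRing.Theory.
Local Open Scope ring_scope.

(** * Kernels of linearized polynomials and fixed fields of Frobenius powers *)

Section LinearizedPolynomials.
Variables (F : finFieldType) (p : nat).
Hypothesis charF : p \in [pchar F].

Lemma frobD n (x y : F) : (x + y) ^+ (p ^ n) = x ^+ (p ^ n) + y ^+ (p ^ n).
Proof.
apply: exprDn_pchar.
by rewrite pnatX pnatE ?charF // (pcharf_prime charF).
Qed.

Lemma frobB n (x y : F) : (x - y) ^+ (p ^ n) = x ^+ (p ^ n) - y ^+ (p ^ n).
Proof. by apply/eqP; rewrite -subr_eq opprK -frobD subrK. Qed.

Lemma frob0 n : (0 : F) ^+ (p ^ n) = 0.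
Proof. by rewrite expr0n expn_eq0 -leqn0 leqNgt prime_gt0 // (pcharf_prime charF). Qed.

Lemma frob_sum n (I : Type) (r : seq I) (P : pred I) (f : I -> F) :
  (\sum_(i <- r | P i) f i) ^+ (p ^ n) = \sum_(i <- r | P i) f i ^+ (p ^ n).
Proof. by apply: (big_morph (fun x => x ^+ (p ^ n))); [exact: frobD|exact: frob0]. Qed.

Lemma frobX i j (x : F) : x ^+ (p ^ i) ^+ (p ^ j) = x ^+ (p ^ (i + j)).
Proof. by rewrite -exprM -expnD. Qed.

Lemma frob_inj n : injective (fun x : F => x ^+ (p ^ n)).
Proof.
move=> x y /eqP; rewrite -subr_eq0 -frobB expf_eq0 subr_eq0.
by case/andP=> _ /eqP.
Qed.

Definition frobfix d : {set F} := [set x | x ^+ (p ^ d) == x].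

(** A linearized polynomial in the Frobenius [x |-> x^(p^d)]. [D] counts coefficients, so [D.+1]
    means degree at most [D]. *)
Definition frobpoly d (c : nat -> F) D x := \sum_(i < D) c i * x ^+ (p ^ (d * i)).

(** Each nonempty fibre of [g] is carried into the kernel of [g] by a translation. *)
Lemma card_additive_preim (g : F -> F) (B : {set F}) :
  {morph g : x y / x - y} ->
  (#|[set x | g x \in B]| <= #|[set x | g x == 0%R]| * #|B|)%N.
Proof.
move=> gB; rewrite -sum1_card (partition_big g (mem B)) /=; last first.
  by move=> x; rewrite inE.
rewrite mulnC -sum_nat_const; apply: leq_sum => z zB; rewrite sum1_card.
case: (pickP [pred x | g x == z]) => [x0 /= /eqP gx0|noz]; last first.
  rewrite eq_card0 // => x; rewrite unfold_in /= andbC.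
  by have /= -> := noz x.
rewrite -(card_imset _ (addIr (- x0))); apply/subset_leq_card/subsetP => y.
by case/imsetP=> x; rewrite !inE => /andP[_ /eqP gx] ->; rewrite gB gx gx0 subrr.
Qed.

(* A nonzero root v lets one write L(v y) = L1(y^(p^d) - y) with L1 one degree
   lower, by Abel summation. *)
Lemma card_frobpoly_ker_lead d c D : c D != 0 ->
  (#|[set x | frobpoly d c D.+1 x == 0%R]| <= #|frobfix d| ^ D)%N.
Proof.
elim: D c => [|D IH] c cD.
  rewrite expn0 -[X in (_ <= X)%N](cards1 (0 : F)); apply/subset_leq_card/subsetP => x.
  rewrite !inE /frobpoly. by rewrite big_ord1 muln0 expr1 mulf_eq0 (negPf cD).
have fix_gt0 : (0 < #|frobfix d|)%N.
  by apply/card_gt0P; exists 0; rewrite inE frob0.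
case: (pickP [pred v | (v != 0) && (frobpoly d c D.+2 v == 0)]) => [v|no]; last first.
  apply: (@leq_trans 1%N); last by rewrite expn_gt0 fix_gt0.
  rewrite -[X in (_ <= X)%N](cards1 (0 : F)); apply/subset_leq_card/subsetP => x.
  by rewrite !inE => x0; move: (no x) => /=; rewrite x0 andbT => /negbFE.
move=> /= /andP[v0 /eqP Lv].
pose c' i := c i * v ^+ (p ^ (d * i)).
pose c1 l := \sum_(i < D.+2 | (l < i)%N) c' i.
have c1D : c1 D != 0.
  rewrite /c1 (big_pred1 ord_max) ?mulf_neq0 ?expf_neq0 // => i.
  by rewrite /= -val_eqE /= eqn_leq [in RHS](leq_ord i).
have LE y : frobpoly d c D.+2 (v * y) = frobpoly d c1 D.+1 (y ^+ (p ^ d) - y).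
  have -> : frobpoly d c D.+2 (v * y) =
      \sum_(i < D.+2) c' i * (y ^+ (p ^ (d * i)) - y).
    under [RHS]eq_bigr => i _ do rewrite mulrBr.
    rewrite big_split /= sumrN -mulr_suml -[X in _ - X * _]/(frobpoly d c D.+2 v) Lv.
    by rewrite mul0r subr0; apply: eq_bigr => i _; rewrite exprMn mulrA.
  have tele (i : 'I_D.+2) : y ^+ (p ^ (d * i)) - y =
      \sum_(l < D.+1 | (l < i)%N) (y ^+ (p ^ d) - y) ^+ (p ^ (d * l)).
    rewrite -(big_ord_widen D.+1 (fun l => (y ^+ (p ^ d) - y) ^+ (p ^ (d * l)))) //; last by rewrite -ltnS.
    rewrite -(big_mkord xpredT (fun l => (y ^+ (p ^ d) - y) ^+ (p ^ (d * l)))).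
    under eq_bigr => l _ do rewrite frobB frobX -mulnS.
    by rewrite (telescope_sumr (fun l => y ^+ (p ^ (d * l)))) // muln0 expr1.
  under eq_bigr => i _ do rewrite tele mulr_sumr.
  rewrite (exchange_big_dep xpredT) //=; apply: eq_bigr => l _.
  by rewrite mulr_suml.
(* Up to the factor [v], the kernel of L is the preimage of the kernel of L1 under
   [y |-> y^(p^d) - y]. That map has kernel [frobfix d], so each degree costs one factor
   [#|frobfix d|]. *)
rewrite -(card_preimset _ (mulfI v0)).
have -> : *%R v @^-1: [set x | frobpoly d c D.+2 x == 0] =
   [set y | y ^+ (p ^ d) - y \in [set x | frobpoly d c1 D.+1 x == 0]].
  by apply/setP => y; rewrite !inE LE.
apply: leq_trans (card_additive_preim _ _ _) _.
  by move=> x y; rewrite frobB opprD addrACA -opprD.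
rewrite expnS leq_mul ?IH //.
by apply/subset_leq_card/subsetP => x; rewrite !inE subr_eq0.
Qed.

Lemma card_frobpoly_ker d c D : (exists2 i, (i <= D)%N & c i != 0) ->
  (#|[set x | frobpoly d c D.+1 x == 0%R]| <= #|frobfix d| ^ D)%N.
Proof.
elim: D => [|D IH] [i iD ci].
  by apply: card_frobpoly_ker_lead; move: iD ci; rewrite leqn0 => /eqP ->.
have [cD|] := eqVneq (c D.+1) 0; last exact: card_frobpoly_ker_lead.
have fix_gt0 : (0 < #|frobfix d|)%N.
  by apply/card_gt0P; exists 0; rewrite inE frob0.
apply: leq_trans (leq_pexp2l fix_gt0 (leqnSn D)).
have -> : [set x | frobpoly d c D.+2 x == 0] = [set x | frobpoly d c D.+1 x == 0].
  by apply/setP => x; rewrite !inE /frobpoly big_ord_recr /= cD mul0r addr0.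
apply: IH; exists i => //; rewrite -ltnS ltn_neqAle iD andbT.
by apply: contraNneq ci => ->; rewrite cD.
Qed.

Lemma card_frobfix_le e : (0 < e)%N -> (#|frobfix e| <= p ^ e)%N.
Proof.
move=> e0; have p1 : (1 < p ^ e)%N.
  by rewrite -(exp1n e) ltn_exp2r // prime_gt1 // (pcharf_prime charF).
have sz : size ('X^(p ^ e) - 'X : {poly F}) = (p ^ e).+1.
  by rewrite size_polyDl ?size_polyXn // size_polyN size_polyX.
have := @max_poly_roots F ('X^(p ^ e) - 'X) (enum (frobfix e)).
rewrite sz ltnS -cardE; apply; last exact: enum_uniq.
  by rewrite -size_poly_eq0 sz.
by apply/allP => x; rewrite mem_enum inE /root !hornerE subr_eq0.
Qed.

(* y^(p^e) - y has trace 0 (additive Hilbert 90), and the trace is a linearized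
   polynomial of degree m / e - 1. *)
Lemma card_frobfix m e : (0 < e)%N -> (0 < m)%N -> #|F| = (p ^ m)%N -> (e %| m)%N ->
  #|frobfix e| = (p ^ e)%N.
Proof.
move=> e0 m0 cF em; apply/eqP; rewrite eqn_leq card_frobfix_le //=.
have r0 : (0 < m %/ e)%N by rewrite divn_gt0 // dvdn_leq.
(* Compare r-th powers for r = m / e: (p^e)^r = |F|, while |F| is at most |K| times the size of the
   trace kernel, hence at most |K|^r, where K is [frobfix e]. *)
rewrite -(leq_exp2r _ _ r0) -expnM [(e * _)%N]mulnC divnK // -cF.
pose B := [set x | frobpoly e (fun=> 1) (m %/ e) x == 0].
have BE y : y ^+ (p ^ e) - y \in B.
  rewrite inE /frobpoly.
  under eq_bigr => l _ do rewrite mul1r frobB frobX -mulnS.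
  rewrite -(big_mkord xpredT (fun l => y ^+ (p ^ (e * l.+1)) - y ^+ (p ^ (e * l)))).
  rewrite (telescope_sumr (fun l => y ^+ (p ^ (e * l)))) // muln0 expr1.
  by rewrite mulnC divnK // -cF expf_card subrr.
have -> : #|F| = #|[set y : F | y ^+ (p ^ e) - y \in B]|.
  by apply/esym/eq_card => y; rewrite inE BE.
apply: leq_trans (card_additive_preim _ _ _) _.
  by move=> x y; rewrite frobB opprD addrACA -opprD.
rewrite -[X in (_ <= _ ^ X)%N](prednK r0) expnS leq_mul //.
  by apply/subset_leq_card/subsetP => x; rewrite !inE subr_eq0.
rewrite /B -(prednK r0); apply: card_frobpoly_ker; exists 0%N => //.
exact: oner_neq0.
Qed.

(** By Bezout, gcd(m,d) + a d is a multiple u m of m. The Frobenius power of exponent u m is the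
    identity, and the one of exponent a d fixes [x]. *)
Lemma frobfix_gcd m d : (0 < m)%N -> #|F| = (p ^ m)%N ->
  frobfix d \subset frobfix (gcdn m d).
Proof.
move=> m0 cF; apply/subsetP => x; rewrite !inE => /eqP xd.
have iterE t (u : nat) : x ^+ (p ^ t) = x -> x ^+ (p ^ (u * t)) = x.
  by move=> xt; elim: u => [|u IH]; rewrite ?expr1 // mulSn -frobX xt IH.
case: (Bezoutl d m0) => a _ /dvdnP[u Eu].
have : x ^+ (p ^ (gcdn m d + a * d)) = x by rewrite Eu iterE // -cF expf_card.
by rewrite addnC -frobX iterE // => ->.
Qed.

End LinearizedPolynomials.

(** * Character sums, Lagrangian subspaces and quadratic exponential sums *)

Section CharacterSums.

(** Translation by [y0] permutes [M] and multiplies the sum by [chi y0], which differs from 1. *)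
Lemma sum_character (V : finZmodType) (M : {set V}) (chi : V -> int) (y0 : V) :
  {in M &, forall x y, x - y \in M} ->
  {in M &, {morph chi : x y / x + y >-> x * y}} ->
  y0 \in M -> chi y0 != 1 -> \sum_(x in M) chi x = 0.
Proof.
move=> MB chiD My0 chiy0.
have M0 : 0 \in M by rewrite -(subrr y0) MB.
have MD x : (x + y0 \in M) = (x \in M).
  apply/idP/idP => Mx; first by rewrite -(addrK y0 x) MB.
  by rewrite -[y0]opprK MB // -[- y0]add0r MB.
have : chi y0 * \sum_(x in M) chi x = \sum_(x in M) chi x.
  rewrite [RHS](reindex_inj (addIr y0)) /= mulr_sumr.
  by apply: eq_big => x; rewrite ?MD // => Mx; rewrite chiD // mulrC.
move/eqP; rewrite -subr_eq0 -[X in _ - X]mul1r -mulrBl mulf_eq0 subr_eq0.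
by rewrite (negPf chiy0) => /eqP.
Qed.

Lemma sum_character_cases (V : finZmodType) (M : {set V}) (chi : V -> int) :
  {in M &, forall x y, x - y \in M} ->
  {in M &, {morph chi : x y / x + y >-> x * y}} ->
  \sum_(x in M) chi x = if [forall x in M, chi x == 1] then #|M|%:R else 0.
Proof.
move=> MB chiD; case: ifPn => [/forall_inP chi1|].
  by rewrite -sumr_const; apply: eq_bigr => x /chi1/eqP.
by case/forall_inPn => y0 My0; exact: sum_character.
Qed.

Variables (F : finFieldType) (e : nat) (beta : F -> F -> int).
Hypotheses (charF : 2 \in [pchar F]) (e_gt0 : (0 < e)%N).
Hypotheses (betaDl : forall x y z, beta (x + y) z = beta x z * beta y z)
  (betaC : forall x y, beta x y = beta y x)
  (betaxx : forall x, beta x x = 1)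
  (beta_adj : forall l x y, l \in frobfix F 2 e -> beta (l * x) y = beta x (l * y)).

Local Notation K := (frobfix F 2 e).

Let betaDr x y z : beta x (y + z) = beta x y * beta x z.
Proof. by rewrite ![beta x _]betaC betaDl. Qed.

Let subrD (x y : F) : x - y = x + y.
Proof. by rewrite (oppr_pchar2 charF). Qed.

(** Totally isotropic [K]-subspaces of dimension [mu], for an alternating form written
    multiplicatively as [beta]. The dimension is recorded through the cardinality. *)
Definition selforthogonal (M : {set F}) mu :=
  [/\ 0 \in M,
      {in M &, forall x y, x + y \in M},
      {in M, forall x l, l \in K -> l * x \in M},
      {in M &, forall x y, beta x y = 1} &
      #|M| = (#|K| ^ mu)%N].

(** The larger subspace is M + K x. *)
Lemma selforthogonal_extend M mu x :
  selforthogonal M mu -> x \notin M -> {in M, forall y, beta x y = 1} ->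
  exists2 M' : {set F}, M \proper M' & selforthogonal M' mu.+1.
Proof.
case=> M0 MD MZ Mo Mcard xM xo.
pose f (u : F * F) := u.1 + u.2 * x.
have K0 : 0 \in K by rewrite inE (frob0 F 2 charF).
have KD : {in K &, forall a b, a + b \in K}.
  by move=> a b; rewrite !inE (frobD F 2 charF) => /eqP -> /eqP ->.
have KM : {in K &, forall a b, a * b \in K}.
  by move=> a b; rewrite !inE exprMn => /eqP -> /eqP ->.
exists (f @: setX M K).
  apply/properP; split.
    apply/subsetP => y My; apply/imsetP; exists (y, 0); last by rewrite /f /= mul0r addr0.
    by rewrite inE My K0.
  exists x => //; apply/imsetP; exists (0, 1); last by rewrite /f /= mul1r add0r.
  by rewrite inE M0 inE expr1n eqxx.
(* Every [l] in [K] is a square r^2 with r = l^(2^(e-1)) in [K], so beta(x, l x) = beta(r x, r x) =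
   1. *)
have betaKx l : l \in K -> beta x (l * x) = 1.
  move=> Kl; have -> : l = l ^+ (2 ^ e.-1) * l ^+ (2 ^ e.-1).
    by move: Kl; rewrite inE => /eqP {1}<-; rewrite -expr2 -exprM -expnSr prednK.
  have Kr : l ^+ (2 ^ e.-1) \in K.
    by move: Kl; rewrite !inE exprAC => /eqP ->.
  by rewrite -mulrA -beta_adj.
split.
- by apply/imsetP; exists (0, 0); [rewrite in_setX M0 K0|rewrite /f mul0r addr0].
- move=> _ _ /imsetP[[y a] /setXP[/= My Ka] ->] /imsetP[[z b] /setXP[/= Mz Kb] ->].
  apply/imsetP; exists (y + z, a + b); last by rewrite /f /= mulrDl addrACA.
  by rewrite inE /= MD // KD.
- move=> _ /imsetP[[y a] /setXP[/= My Ka] ->] l Kl.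
  apply/imsetP; exists (l * y, l * a); last by rewrite /f /= mulrDr mulrA.
  by rewrite inE /= MZ // KM.
- move=> _ _ /imsetP[[y a] /setXP[/= My Ka] ->] /imsetP[[z b] /setXP[/= Mz Kb] ->].
  have byx : beta y (b * x) = 1 by rewrite betaC beta_adj // xo ?MZ.
  have bxz : beta (a * x) z = 1 by rewrite beta_adj // xo ?MZ.
  have bxx : beta (a * x) (b * x) = 1 by rewrite beta_adj // mulrA betaKx ?KM.
  by rewrite /f /= betaDl !betaDr Mo // byx bxz bxx !mul1r.
(* The sum M + K x is direct: y + a x = z + b x with a different from b would give x = (y + z) / (a
   + b), an element of [M]. *)
- rewrite card_in_imset ?cardsX ?Mcard ?expnSr //.
  move=> [y a] [z b] /setXP[/= My Ka] /setXP[/= Mz Kb]; rewrite /f /= => E.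
  have yz : y + z = (a + b) * x.
    by apply/eqP; rewrite -subr_eq0 subrD mulrDl addrACA E (addrr_pchar2 charF).
  have [ab|nab] := eqVneq a b.
    by congr (_, _) => //; move: E; rewrite ab => /addIr.
  have ab0 : a + b != 0 by rewrite -subrD subr_eq0.
  case/negP: xM; have -> : x = (a + b)^-1 * (y + z) by rewrite yz mulKf.
  apply: MZ; first exact: MD.
  by have := KD _ _ Ka Kb; rewrite !inE exprVn => /eqP ->.
Qed.

Lemma exists_lagrangian : exists (M : {set F}) (mu : nat),
  selforthogonal M mu /\ forall x, {in M, forall y, beta x y = 1} -> x \in M.
Proof.
(* The counter [c] bounds |F| - |M|, which drops at every proper extension; the extensions start
   from the zero subspace. *)
suff H c M mu : selforthogonal M mu -> (#|F| - #|M| < c)%N ->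
    exists (M : {set F}) (mu : nat),
    selforthogonal M mu /\ forall x, {in M, forall y, beta x y = 1} -> x \in M.
  apply: (H #|F|.+1 [set 0] 0%N); last by rewrite ltnS leq_subr.
  have b0 y : beta 0 y = 1.
    by rewrite -(mul0r 0) beta_adj ?mul0r ?betaxx // inE (frob0 F 2 charF).
  split.
  - exact: set11.
  - by move=> x y /set1P -> /set1P ->; rewrite addr0 set11.
  - by move=> x /set1P -> l _; rewrite mulr0 set11.
  - by move=> x y /set1P ->.
  - by rewrite cards1.
elim: c M mu => // c IH M mu Mo Mc.
case: (pickP [pred x | (x \notin M) && [forall y in M, beta x y == 1]]) => [x|no].
  case/andP=> xM /forall_inP xo.
  have [|M' MM' Mo'] := selforthogonal_extend M mu x Mo xM; first by move=> y /xo/eqP.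
  apply: (IH _ _ Mo'); rewrite -ltnS; apply: leq_trans Mc; rewrite ltnS.
  by apply: ltn_sub2l; [exact: leq_trans (proper_card MM') (max_card _)|exact: proper_card].
exists M, mu; split=> // x xo; apply: contraFT (no x) => /= ->.
by apply/forall_inP => y /xo ->.
Qed.

Definition radical := [set x : F | [forall y, beta x y == 1]].

Lemma sum_pairing y : \sum_x beta x y = if y \in radical then #|F|%:R else 0.
Proof.
have := @sum_character_cases F setT (beta^~ y).
rewrite cardsT inE => H.
rewrite (eq_bigl (fun x => x \in setT)); last by move=> x; rewrite inE.
rewrite H; first last.
- by move=> a b _ _; rewrite betaDl.
- by move=> a b; rewrite !inE.
congr (if _ then _ else _); apply/forall_inP/forallP => h x; first by rewrite betaC h ?inE.
by rewrite betaC.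
Qed.

(** Sum [beta] over F x M in two ways. Summing over M first leaves |M| for each x orthogonal to M,
    that is, for each x in M. Summing over F first leaves |F| for each y in the radical, which lies
    in M. *)
Lemma card_lagrangian : exists mu, (#|K| ^ (2 * mu) = #|F| * #|radical|)%N.
Proof.
have [M [mu [[M0 MD MZ Mo Mcard] Mmax]]] := exists_lagrangian.
exists mu; rewrite mulnC expnM -Mcard; apply/eqP; rewrite -(Num.Theory.eqr_nat int) natrX natrM.
have <- : \sum_x \sum_(y in M) beta x y = #|M|%:R ^+ 2 :> int.
  under eq_bigr => x _.
    rewrite sum_character_cases; first last.
    - by move=> a b _ _; rewrite betaDr.
    - by move=> a b Ma Mb; rewrite subrD MD.
    over.
  rewrite -big_mkcond /= (eq_bigl (mem M)) ?sumr_const ?expr2 ?mulr_natr // => x.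
  apply/forall_inP/idP => [h|Mx y My]; last by rewrite Mo.
  by apply: Mmax => y /h/eqP.
rewrite exchange_big /=.
have WM : radical \subset M.
  by apply/subsetP => x; rewrite inE => /forallP h; apply: Mmax => y _; exact/eqP.
under eq_bigr => y _ do rewrite sum_pairing.
rewrite -big_mkcondr (eq_bigl (mem radical)) ?sumr_const ?mulr_natr // => x /=.
by apply: andb_idl => /(subsetP WM).
Qed.

Variable theta : F -> int.
Hypotheses (theta_sqr : forall x, theta x ^+ 2 = 1)
  (thetaD : forall x y, theta (x + y) = theta x * theta y * beta x y).

Lemma quadratic_sum : exists mu,
  (#|K| ^ (2 * mu) = #|F| * #|radical|)%N /\
  let S := \sum_x theta x in
  [\/ S = 0, S = (#|K| ^ mu)%:R | S = - (#|K| ^ mu)%:R].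
Proof.
have [mu Emu] := card_lagrangian; exists mu; split=> //=.
set S := \sum_x theta x.
(* In the double sum, substitute x + z for the second variable: theta(x) theta(x + z) = theta(z)
   beta(x, z), and summing over x keeps only the z in the radical. *)
have S2 : S ^+ 2 = #|F|%:R * \sum_(z in radical) theta z.
  rewrite expr2 {1}/S mulr_suml.
  under eq_bigr => x _ do rewrite /S (reindex_inj (addrI x)) /= mulr_sumr.
  rewrite exchange_big /= mulr_sumr [RHS]big_mkcond /=; apply: eq_bigr => z _.
  transitivity (theta z * \sum_x beta x z).
    rewrite mulr_sumr; apply: eq_bigr => x _.
    by rewrite thetaD !mulrA -expr2 theta_sqr mul1r.
  by rewrite sum_pairing; case: ifP; rewrite ?mulr0 // mulrC.
have radB : {in radical &, forall x y, x - y \in radical}.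
  move=> x y; rewrite !inE => /forallP hx /forallP hy; apply/forallP => z.
  by rewrite subrD betaDl (eqP (hx z)) (eqP (hy z)).
rewrite sum_character_cases // in S2; last first.
  move=> x y; rewrite inE => /forallP hx _.
  by rewrite thetaD (eqP (hx y)) mulr1.
move: S2; case: ifP => _ S2; last first.
  by constructor 1; apply/eqP; rewrite -sqrf_eq0 S2 mulr0.
move: S2; rewrite -natrM -Emu mulnC expnM natrX => /eqP.
by rewrite eqf_sqr => /orP[] /eqP; [constructor 2|constructor 3].
Qed.

End CharacterSums.

(** * Traces in characteristic 2 *)

Section Traces.
Variable F : finFieldType.
Hypothesis charF : 2 \in [pchar F].

Lemma TrD N q (x y : F) : Tr N q (x + y) = Tr N q x + Tr N q y.
Proof. by rewrite /Tr -big_split; apply: eq_bigr => i _; rewrite (frobD F 2). Qed.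

Lemma Tr0 N q : Tr N q (0 : F) = 0.
Proof. by rewrite /Tr big1 // => i _; rewrite (frob0 F 2). Qed.

Lemma Tr_sum N q (I : Type) (r : seq I) (P : pred I) (f : I -> F) :
  Tr N q (\sum_(i <- r | P i) f i) = \sum_(i <- r | P i) Tr N q (f i).
Proof. by apply: (big_morph (Tr N q)); [exact: TrD|exact: Tr0]. Qed.

Lemma Tr_absE N (y : F) : Tr N 1 y = \sum_(i < N) y ^+ (2 ^ i).
Proof. by rewrite /Tr divn1; apply: eq_bigr => i _; rewrite mul1n. Qed.

Lemma Tr_tower N e (y : F) : (e %| N)%N -> Tr e 1 (Tr N e y) = Tr N 1 y.
Proof.
(* If e = 0 then N = 0 and both absolute traces are empty sums. *)
case/dvdnP=> r ->; have [->|e0] := posnP e; first by rewrite muln0 !Tr_absE !big_ord0.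
rewrite /Tr mulnK // -!/(Tr _ 1 _); elim: r => [|r IH].
  by rewrite big_ord0 Tr0 Tr_absE big_ord0.
rewrite big_ord_recr /= TrD IH !Tr_absE mulSnr big_split_ord /=; congr (_ + _).
by apply: eq_bigr => i _; rewrite (frobX F 2) mulnC.
Qed.

(** Raising t by one changes the trace by a telescoping sum, y^(2^(t+N)) - y^(2^t), which is
    zero. *)
Lemma Tr_frob N t (y : F) : y ^+ (2 ^ N) = y -> Tr N 1 (y ^+ (2 ^ t)) = Tr N 1 y.
Proof.
move=> yN; elim: t => [|t IH]; first by rewrite expr1.
rewrite -IH; apply/eqP; rewrite -subr_eq0 !Tr_absE -sumrB.
under eq_bigr => i _ do rewrite !(frobX F 2) addSnnS.
rewrite -(big_mkord xpredT (fun i => y ^+ (2 ^ (t + i.+1)) - y ^+ (2 ^ (t + i)))).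
rewrite (telescope_sumr (fun i => y ^+ (2 ^ (t + i)))) // addn0 addnC -(frobX F 2).
by rewrite yN subrr.
Qed.

Lemma Tr_sqr N (y : F) : y ^+ (2 ^ N) = y -> Tr N 1 y ^+ 2 = Tr N 1 y.
Proof.
move=> yN; rewrite -[RHS](Tr_frob N 1 y) // -[LHS]/(_ ^+ (2 ^ 1)) !Tr_absE (frob_sum F 2) //.
by apply: eq_bigr => i _; rewrite !(frobX F 2) addnC.
Qed.

(** Pairs the exponents i and n + i. This turns the cross terms of the [a0] part, traced from
    F_{2^n}, into a trace from F_{2^m}. *)
Lemma Tr_half n (z : F) : Tr (2 * n) 1 z = Tr n 1 (z + z ^+ (2 ^ n)).
Proof.
rewrite TrD !Tr_absE mul2n -addnn big_split_ord /=; congr (_ + _).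
by apply: eq_bigr => i _; rewrite (frobX F 2).
Qed.

(** If z were nonzero, the trace would vanish on all of F; but it is a linearized polynomial of
    degree m - 1 in the squaring map, so its kernel has at most 2^(m-1) elements. *)
Lemma Tr_nondegenerate m (z : F) : (0 < m)%N -> #|F| = (2 ^ m)%N ->
  (forall y, Tr m 1 (y * z) = 0) -> z = 0.
Proof.
move=> m0 cF Tz; apply/eqP; apply: contraT => z0.
have TrE x : frobpoly F 2 1 (fun=> 1) m.-1.+1 x = Tr m 1 x.
  by rewrite prednK // /Tr divn1; apply: eq_bigr => i _; rewrite mul1r.
have : (#|[set x | frobpoly F 2 1 (fun=> 1%R) m.-1.+1 x == 0%R]| <= #|frobfix F 2 1| ^ m.-1)%N.
  by apply: card_frobpoly_ker => //; exists 0%N => //; exact: oner_neq0.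
have -> : [set x | frobpoly F 2 1 (fun=> 1) m.-1.+1 x == 0] = [set: F].
  by apply/setP => x; rewrite !inE TrE -(mulfVK z0 x) Tz eqxx.
move=> kerT; have le2 : (#|frobfix F 2 1| ^ m.-1 <= 2 ^ m.-1)%N.
  by case: (m.-1) => // r; rewrite leq_exp2r // (card_frobfix_le F 2 charF 1).
by move: (leq_trans kerT le2); rewrite cardsT cF leq_exp2l // leqNgt prednK // leqnn.
Qed.

End Traces.

(** * Signs of bits, and sums over the powers of a primitive element *)

Section Sign.
Variable F : finFieldType.
Hypothesis charF : 2 \in [pchar F].

Definition sign (u : F) : int := if u == 0 then 1 else -1.

Lemma sign_sqr u : sign u ^+ 2 = 1.
Proof. by rewrite /sign; case: ifP; rewrite ?sqrrN expr1n. Qed.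

Lemma sign_eq1 u : (sign u == 1) = (u == 0).
Proof. by rewrite /sign; case: ifP. Qed.

(** The hypotheses place [u] and [v] in F_2, where [sign] is the character (-1)^u. *)
Lemma signD u v : u ^+ 2 = u -> v ^+ 2 = v -> sign (u + v) = sign u * sign v.
Proof.
have bit (w : F) : w ^+ 2 = w -> w = 0 \/ w = 1.
  move/eqP; rewrite -subr_eq0 expr2 -{3}[w]mulr1 -mulrBr mulf_eq0 subr_eq0.
  by case/orP=> /eqP; [left|right].
rewrite /sign => /bit[] -> /bit[] ->; rewrite ?addr0 ?add0r ?eqxx ?oner_eq0 ?mul1r ?mulr1 //.
by rewrite (addrr_pchar2 charF) eqxx mulrNN mulr1.
Qed.

End Sign.

Lemma sum_prim_root (F : finFieldType) (N : nat) (z : F) (f : F -> int) :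
  N.-primitive_root z -> N = #|F|.-1 ->
  \sum_(i < N) f (z ^- i) = \sum_x f x - f 0.
Proof.
move=> zN NF; have N0 := prim_order_gt0 zN.
have z0 : z != 0 by rewrite (prim_root_eq0 zN) -lt0n.
rewrite [X in _ = X - _](bigD1 0) //= [f 0 + _]addrC addrK.
have inj : {in 'I_N &, injective (fun i => z ^- (nat_of_ord i))}.
  move=> i j _ _ /invr_inj /eqP; rewrite (eq_prim_root_expr zN) !modn_small //.
  by move/eqP/val_inj.
have im : [set z ^- (nat_of_ord i) | i in 'I_N] = [set~ 0].
  apply/eqP; rewrite eqEcard cardsC1 card_in_imset // card_ord -NF leqnn andbT.
  by apply/subsetP => _ /imsetP[i _ ->]; rewrite !inE invr_eq0 expf_neq0.
rewrite (eq_bigl (mem [set~ 0])); last by move=> x; rewrite !inE.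
by rewrite -im big_imset.
Qed.

(** * The quadratic form of a codeword, its polar form and its exponential sum *)

Section QuadraticForm.
Variables (F : finFieldType) (n d e k : nat).
Hypotheses (n_gt0 : (0 < n)%N) (e_def : e = gcdn n d) (e_def2 : e = gcdn (2 * n) d)
  (cardF : #|F| = (2 ^ (2 * n))%N).
Hypothesis kN : (k.+1 <= n %/ e)%N.
Variables (a0 : F) (a : nat -> F).
Hypothesis a0n : a0 ^+ (2 ^ n) = a0.

Local Notation m := (2 * n)%N.
Local Notation N := (n %/ e)%N.

Let charF : 2 \in [pchar F]. Proof. exact: card_finPcharP cardF _. Qed.

Let e_gt0 : (0 < e)%N. Proof. by rewrite e_def gcdn_gt0 n_gt0. Qed.

Let en : (e %| n)%N. Proof. by rewrite e_def dvdn_gcdl. Qed.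

Let ed : (e %| d)%N. Proof. by rewrite e_def dvdn_gcdr. Qed.

(** If d / e were even, 2 e would divide both d and 2 n, hence their gcd, which is e. *)
Lemma gcd_odd_quotient : odd (d %/ e).
Proof.
apply: contraT => ev.
have e2d : (2 * e %| d)%N by rewrite -(divnK ed) dvdn_pmul2r // dvdn2.
have : (2 * e %| e)%N by rewrite {2}e_def2 dvdn_gcd e2d dvdn_pmul2l // en.
by move/dvdn_leq => /(_ e_gt0); rewrite leqNgt -{1}[e]mul1n ltn_pmul2r.
Qed.

Let frobm u (x : F) : x ^+ (2 ^ (u * m)) = x.
Proof.
elim: u => [|u IH]; first by rewrite expr1.
by rewrite mulSn -(frobX F 2) -cardF expf_card.
Qed.

Let dNn : (d * N = d %/ e * n)%N.
Proof. by rewrite -{1}(divnK ed) -mulnA [(e * _)%N]mulnC divnK. Qed.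

Let dN : (d * N = n + (d %/ e)./2 * m)%N.
Proof.
by rewrite dNn -{1}[(d %/ e)%N]odd_double_half gcd_odd_quotient; lia.
Qed.

(** Since d / e is odd, d N = (d / e) n is congruent to n modulo m. *)
Lemma frob_half (x : F) : x ^+ (2 ^ (d * N)) = x ^+ (2 ^ n).
Proof. by rewrite dN -(frobX F 2) frobm. Qed.

(** The k of the theorem is [k.+1] here, which keeps truncated subtraction out of the degree
    bounds. *)
Definition quad x := Tr e 1 (Qa m n d e k.+1 a0 a x).

(** The linear map L for which the polar form is Tr(y L(x)). Each middle term contributes itself and
    its adjoint under the trace form; the [a0] term contributes only once, by [Tr_half]. *)
Definition polar_map x := a0 * x ^+ (2 ^ (d * N)) +
  \sum_(1 <= j < k.+1) (a j * x ^+ (2 ^ (d * (N - j))) +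
    (a j * x) ^+ (2 ^ (d * (N + j)))).

Lemma quadE x : quad x = Tr n 1 (a0 * x ^+ (2 ^ n + 1)) +
  \sum_(1 <= j < k.+1) Tr m 1 (a j * x ^+ (2 ^ (d * (N - j)) + 1)) +
  Tr m 1 (a k.+1 * x).
Proof.
have em : (e %| m)%N by rewrite dvdn_mull.
have -> : x ^+ (2 ^ n + 1) = x ^+ (2 ^ (n * d %/ e) + 1).
  by rewrite !addn1 !exprSr -frob_half muln_divA // mulnC.
rewrite /quad /Qa !(TrD F charF) !(Tr_tower F charF) //; congr (_ + _ + _).
rewrite (Tr_sum F charF).
by apply: eq_bigr => j _; rewrite (Tr_tower F charF) // [(_ * d)%N]mulnC.
Qed.

Let fixm (x : F) : x ^+ (2 ^ m) = x. Proof. by rewrite -[m]mul1n frobm. Qed.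

Lemma quad_sqr x : quad x ^+ 2 = quad x.
Proof.
rewrite quadE -[_ ^+ 2]/(_ ^+ (2 ^ 1)) !(frobD F 2 charF) (frob_sum F 2 charF).
rewrite -![_ ^+ (2 ^ 1)]/(_ ^+ 2) !(Tr_sqr F charF) //; last first.
  (* x^(2^n + 1) is the norm of x to F_{2^n}, so the [a0] term is fixed by the n-th Frobenius
     power. *)
  by rewrite exprMn a0n addn1 exprS exprMn (frobX F 2) addnn -mul2n fixm [x * _]mulrC.
by congr (_ + _ + _); apply: eq_bigr => j _; rewrite (Tr_sqr F charF).
Qed.

Lemma quadD x y : quad (x + y) = quad x + quad y + Tr m 1 (y * polar_map x).
Proof.
(* The cross terms are z + z^(2^n) with z = a0 y x^(2^n). *)
have top : Tr n 1 (a0 * (x + y) ^+ (2 ^ n + 1)) =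
    Tr n 1 (a0 * x ^+ (2 ^ n + 1)) + Tr n 1 (a0 * y ^+ (2 ^ n + 1)) +
    Tr m 1 (y * (a0 * x ^+ (2 ^ (d * N)))).
  rewrite frob_half (Tr_half F charF) !exprMn a0n (frobX F 2) addnn -mul2n fixm.
  rewrite -!(TrD F charF) !addn1 !exprSr (frobD F 2 charF); congr (Tr _ _ _).
  by move: (x ^+ _) (y ^+ _) => X Y; ring.
have mid j : (1 <= j < k.+1)%N -> Tr m 1 (a j * (x + y) ^+ (2 ^ (d * (N - j)) + 1)) =
    Tr m 1 (a j * x ^+ (2 ^ (d * (N - j)) + 1)) +
    Tr m 1 (a j * y ^+ (2 ^ (d * (N - j)) + 1)) +
    Tr m 1 (y * (a j * x ^+ (2 ^ (d * (N - j))) + (a j * x) ^+ (2 ^ (d * (N + j))))).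
  move=> /andP[_ jk].
  (* The exponents t and u add up to 2 d N = (d / e) m, so the Frobenius powers 2^t and 2^u are
     mutually inverse; this moves the power from y onto a_j x inside the trace. *)
  have [t Et] : exists t, t = (d * (N - j))%N by eexists.
  have [u Eu] : exists u, u = (d * (N + j))%N by eexists.
  have ut (z : F) : z ^+ (2 ^ (t + u)) = z.
    have -> : (t + u = (d %/ e) * m)%N; last exact: frobm.
    rewrite Et Eu -mulnDr; have -> : (N - j + (N + j) = 2 * N)%N by lia.
    by rewrite !(mulnCA _ 2) dNn.
  rewrite -Et -Eu mulrDr (TrD F charF _ _ (y * (a j * _))).
  rewrite -[Tr m 1 (y * (a j * x) ^+ _)](Tr_frob F m t) // exprMn (frobX F 2).
  rewrite [(u + t)%N]addnC ut.
  rewrite -!(TrD F charF) !addn1 !exprSr (frobD F 2 charF); congr (Tr _ _ _).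
  by move: (x ^+ _) (y ^+ _) => X Y; ring.
rewrite !quadE top (eq_big_nat _ _ mid) !big_split /= /polar_map [y * (_ + _)]mulrDr.
rewrite !(TrD F charF) mulr_sumr (Tr_sum F charF) mulrDr (TrD F charF).
by ring.
Qed.

Lemma polar_mapD : {morph polar_map : x y / x + y}.
Proof.
move=> x y; rewrite /polar_map addrACA -big_split (frobD F 2 charF) mulrDr; congr (_ + _).
apply: eq_bigr => j _; rewrite (frobD F 2 charF) mulrDr.
by rewrite mulrDr (frobD F 2 charF) addrACA.
Qed.

(** As e divides d, every Frobenius power occurring in [polar_map] fixes [l]. This makes the pairing
    adjoint for scalars of F_{2^e}. *)
Lemma polar_mapZ l x : l \in frobfix F 2 e -> polar_map (l * x) = l * polar_map x.
Proof.
rewrite inE => /eqP le; have ld i : l ^+ (2 ^ (d * i)) = l.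
  rewrite -(divnK ed) mulnAC; elim: (d %/ e * i)%N => [|u IH]; first by rewrite expr1.
  by rewrite mulSn -(frobX F 2) le.
rewrite /polar_map [RHS]mulrDr mulr_sumr exprMn ld mulrCA; congr (_ + _).
apply: eq_bigr => j _; rewrite !exprMn !ld.
by move: (x ^+ _) (x ^+ _) (a j ^+ _) => X Y A; ring.
Qed.

(* With k one less than in the theorem, [polar_map] only involves the Frobenius powers d(N-k), ..., d(N+k),
   so its shift by d(N-k) has degree 2k. *)
Definition polar_coef l :=
  if (l < k)%N then a (k - l) else if l == k then a0 else
  a (l - k) ^+ (2 ^ (d * (N + (l - k)))).

(** The range of coefficients splits at l = k: below it lie the terms N - j with j = k - l, in
    reverse order, at it the [a0] term, and above it the terms N + j with j = l - k. *)
Lemma polar_mapE x :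
  polar_map x = frobpoly F 2 d polar_coef (k + k).+1 (x ^+ (2 ^ (d * (N - k)))).
Proof.
pose G l := polar_coef l * x ^+ (2 ^ (d * (N - k + l))).
have -> : frobpoly F 2 d polar_coef (k + k).+1 (x ^+ (2 ^ (d * (N - k)))) =
    \sum_(0 <= l < (k + k).+1) G l.
  by rewrite big_mkord; apply: eq_bigr => l _; rewrite (frobX F 2) -mulnDr.
rewrite (big_cat_nat (n := k)) //=; last by lia.
rewrite (big_ltn (m := k)); last by lia.
rewrite /polar_map big_split /= addrCA; congr (_ + _); last congr (_ + _).
- by rewrite /G /polar_coef ltnn eqxx subnK // ltnW.
- rewrite big_add1 /= big_nat_rev /=; apply: eq_big_nat => j /andP[_ jk].
  by rewrite /G /polar_coef jk; congr (a _ * _ ^+ (2 ^ (d * _))); lia.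
- rewrite -[k.+1]add1n big_addn.
  have -> : ((k + k).+1 - k)%N = k.+1 by lia.
  apply: eq_big_nat => j /andP[j0 jk].
  rewrite /G /polar_coef ifF; last by lia.
  rewrite ifF; last by lia.
  by rewrite addnK exprMn; congr (_ * _ ^+ (2 ^ (d * _))); lia.
Qed.

Definition pairing x y := sign F (Tr m 1 (y * polar_map x)).

Let theta x := sign F (quad x).

Let thetaD x y : theta (x + y) = theta x * theta y * pairing x y.
Proof.
rewrite /theta quadD /pairing !(signD F charF) ?quad_sqr ?(Tr_sqr F charF) //.
by rewrite -[_ ^+ 2]/(_ ^+ (2 ^ 1)) (frobD F 2 charF) -![_ ^+ (2 ^ 1)]/(_ ^+ 2) !quad_sqr.
Qed.

Lemma quad_sum :
  (exists x, quad x != 0) -> let S := \sum_x sign F (quad x) in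
  S = 0 \/ exists j, (j < k.+1)%N /\
    (S = (2 ^ (n + j * e))%:Z \/ S = - (2 ^ (n + j * e))%:Z).
Proof.
case=> x0 qx0 S; have m_gt0 : (0 < m)%N by rewrite muln_gt0.
have theta2 x : theta x ^+ 2 = 1 by exact: sign_sqr.
(* In this form, symmetry and triviality on the diagonal follow from [theta] alone. *)
have pairE x y : pairing x y = theta x * theta y * theta (x + y).
  rewrite thetaD mulrA -expr2 exprMn !theta2.
  by rewrite !mul1r.
case: (pickP [pred i : 'I_(k + k).+1 | polar_coef i != 0]) => [i /= ci|c0]; last first.
  (* With zero polar form, [theta] is a character of F, nontrivial because of [x0]. *)
  left; have L0 x : polar_map x = 0.
    rewrite polar_mapE /frobpoly big1 // => i _.
    by have /= /negbFE/eqP -> := c0 i; rewrite mul0r.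
  rewrite /S (eq_bigl (fun x => x \in setT)) => [|x]; last by rewrite inE.
  apply: (sum_character _ _ _ x0); rewrite ?inE ?sign_eq1 // => x y; rewrite ?inE // => _ _.
  have := thetaD x y; rewrite /pairing L0 mulr0 (Tr0 F charF) /sign eqxx mulr1.
  exact.
have Kcard : #|frobfix F 2 e| = (2 ^ e)%N.
  by apply: (card_frobfix F 2 charF m); rewrite // dvdn_mull.
have q0 : polar_map 0 = 0 by rewrite -(mul0r 0) polar_mapZ ?mul0r // inE (frob0 F 2 charF).
have [||||mu [Emu Ssum]] := quadratic_sum F e pairing charF e_gt0 _ _ _ _ theta theta2 thetaD.
- by move=> x y z; rewrite /pairing polar_mapD mulrDr (TrD F charF) (signD F charF) ?(Tr_sqr F charF).
- by move=> x y; rewrite !pairE addrC [theta x * _]mulrC.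
- move=> x.
  have t0 : theta 0 = 1.
    have := thetaD 0 0; rewrite addr0 /pairing q0 mulr0 (Tr0 F charF) /sign eqxx mulr1.
    by rewrite -expr2 theta2.
  by rewrite pairE (addrr_pchar2 charF) t0 mulr1 -expr2 theta2.
- by move=> l x y Kl; rewrite /pairing polar_mapZ // mulrCA mulrA.
(* By nondegeneracy of the trace the radical is the kernel of [polar_map]. The inner Frobenius power
   is injective, so [card_frobpoly_ker] applies, with a fixed field contained in F_{2^gcd(m,d)} =
   F_{2^e}. *)
have radle : (#|radical F pairing| <= (2 ^ e) ^ (k + k))%N.
  have frob_inj' := @frob_inj F 2 charF (d * (N - k)).
  apply: (@leq_trans #|[set x | frobpoly F 2 d polar_coef (k + k).+1 x == 0%R]|).
    rewrite -[X in (_ <= X)%N](card_preimset _ frob_inj'); apply/subset_leq_card/subsetP => x.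
    rewrite !inE /= -polar_mapE => /forallP h; apply/eqP.
    apply: (Tr_nondegenerate F charF m _ m_gt0 cardF) => y.
    by apply/eqP; rewrite -sign_eq1; exact: h.
  apply: leq_trans (card_frobpoly_ker F 2 charF d _ _ _) _.
    by exists (nat_of_ord i); rewrite // -ltnS.
  case: (k + k)%N => // r; rewrite leq_exp2r // -Kcard e_def2.
  exact/subset_leq_card/(frobfix_gcd F 2).
have rad1 : (0 < #|radical F pairing|)%N.
  apply/card_gt0P; exists 0; rewrite inE; apply/forallP => y.
  by rewrite /pairing q0 mulr0 (Tr0 F charF) /sign eqxx.
(* Since 1 <= |W| <= 2^(2ek), the exponent 2 e mu lies between m and m + 2 e k, where m = 2 e N. The
   index j of the theorem is mu - N. *)
have [muN muk] : (N <= mu)%N /\ (mu <= N + k)%N.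
  move: Emu; rewrite Kcard cardF -expnM => Emu.
  have eN : (e * N = n)%N by rewrite mulnC divnK.
  have lo : (2 ^ m <= 2 ^ (e * (2 * mu)))%N by rewrite Emu leq_pmulr.
  have hi : (2 ^ (e * (2 * mu)) <= 2 ^ (m + e * (k + k)))%N.
    by rewrite Emu expnD leq_mul // expnM.
  move: lo hi; rewrite !leq_exp2l // mulnCA mulnDr => lo hi.
  by split; rewrite -(leq_pmul2l e_gt0) ?mulnDr eN; lia.
have Emu' : (#|frobfix F 2 e| ^ mu = 2 ^ (n + (mu - N) * e))%N.
  by rewrite Kcard -expnM; congr (_ ^ _)%N; rewrite -{1}(divnK en) -mulnDl subnKC // mulnC.
have jk : (mu - N < k.+1)%N by lia.
move: Ssum; rewrite /= Emu' natz -/S.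
by case=> ->; [left|right; exists (mu - N)%N|right; exists (mu - N)%N];
  do ?split=> //; [left|right].
Qed.

End QuadraticForm.

(** * From the exponential sum to the DC component *)

Theorem theorem1p1 (F : finFieldType) (m n d e k : nat)
  (Hm : (0 < m)%N) (Hn : (0 < n)%N) (Hd : (0 < d)%N) (He : (0 < e)%N)
  (Hk : (0 < k)%N)
  (Hmn : m = (2 * n)%N) (Hen : e = gcdn n d) (Hem : e = gcdn m d)
  (Hk1 : (1 <= k <= n %/ e)%N)
  (HF : #|F| = (2 ^ m)%N)
  (pi : F) (Hpi : (2 ^ m - 1).-primitive_root pi)
  (a0 : F) (Ha0 : a0 ^+ (2 ^ n) = a0) (a : nat -> F)
  (Hnz : exists i : nat, (i < 2 ^ m - 1)%N /\ cw m n d e k a0 a pi i != 0) :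
  DC m n d e k a0 a pi = -1 \/
  exists j : nat, (j < k)%N /\
    (DC m n d e k a0 a pi = -1 + (2 ^ (m %/ 2 + j * e))%:Z \/
     DC m n d e k a0 a pi = -1 - (2 ^ (m %/ 2 + j * e))%:Z).
Proof.
have k_prednK : k.-1.+1 = k by rewrite prednK.
have kN : (k.-1.+1 <= n %/ e)%N by rewrite k_prednK; case/andP: Hk1.
have oddm : (2 ^ m - 1)%N = #|F|.-1 by rewrite HF subn1.
have charF : 2 \in [pchar F] by apply: card_finPcharP HF _.
pose q := quad F n d e k.-1 a0 a.
have cwE i : cw m n d e k a0 a pi i = q (pi ^- i).
  by rewrite /cw /q /quad k_prednK Hmn.
have q0 : q 0 = 0.
  rewrite /q /quad /Qa !addn1 !exprS !mul0r !mulr0 !(Tr0 F charF) big1 ?addr0 ?(Tr0 F charF) //.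
  by move=> j _; rewrite addn1 exprS mul0r mulr0 (Tr0 F charF).
(* The powers pi^(-i) run over the nonzero elements; the missing x = 0 accounts for the -1, as q(0)
   = 0. *)
have DCE : DC m n d e k a0 a pi = \sum_x sign F (q x) - 1.
  have := sum_prim_root F _ pi (fun x => sign F (q x)) Hpi oddm.
  rewrite /= q0 [sign F 0]/sign eqxx => <-; apply: eq_bigr => i _.
  by rewrite cwE.
have qnz : exists x, q x != 0.
  by case: Hnz => i [_]; rewrite cwE => qi; exists (pi ^- i).
have n2 : (m %/ 2 = n)%N by rewrite Hmn mulKn.
rewrite Hmn in Hem HF.
rewrite DCE n2.
case: (quad_sum F n d e k.-1 Hn Hen Hem HF kN a0 a Ha0 qnz) => [->|[j [jk Ej]]].
  by left; rewrite sub0r.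
right; exists j; rewrite -k_prednK; split=> //.
by case: Ej => ->; [left|right]; rewrite addrC.
Qed.
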